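(* Let $E$ be an arbitrary nonempty subset of $\mathbb{R}^n$. Let $f:E\to\mathbb{R}$, $G:E\to\mathbb{R}^n$ be functions such that $$\mathrm{span}\{G(x)-G(y) : x, y\in E\}=\mathbb{R}^n.$$ Then there exists a convex function $F\in C^{1,1}_{\mathrm{loc}}(\mathbb{R}^n)$ such that $F_{|_E}=f$ and $(\nabla F)_{|_E}=G$ if and only if for each $k\in \mathbb{N}$ there exists a number $A_k\geq 2$ such that $$f(z)+\langle G(z), x-z\rangle\leq f(y)+\langle G(y), x-y\rangle +\frac{A_k}{2}|x-y|^2$$ for every $z\in E$, every $y\in E\cap B(0, k)$, and every $x\in B(0, 4k)$. Furthermore, if this condition holds with numbers $A_k$ and $G$ is bounded, then a formula for such an extension $F$ is given by $$F=\mathrm{conv}\left( x\mapsto \inf_{y\in E}\left\{f(y)+\langle G(y), x-y\rangle +\tfrac{1}{2}\left( A_{k(y)} +4\|G\|_{\infty}+1\right) |x-y|^2\right\}\right),$$ where $k(y)$ is defined as the first positive integer $k$ such that $y\in B(0, k)$, and $\|G\|_{\infty}:=\sup_{x\in E}|G(x)|$.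
   Context: $\mathbb{N}=\{1,2,3,\dots\}$. $|\cdot|$ and $\langle\cdot,\cdot\rangle$ are the Euclidean norm and inner product of $\mathbb{R}^n$, and $B(x,r)$ denotes the closed ball of center $x$ and radius $r$. $C^{1,1}_{\mathrm{loc}}(\mathbb{R}^n)$ is the class of differentiable functions $\mathbb{R}^n\to\mathbb{R}$ whose gradient is locally Lipschitz (equivalently, Lipschitz on every ball). For a function $g:\mathbb{R}^n\to\mathbb{R}$, $\mathrm{conv}(g)$ denotes its convex envelope, $\mathrm{conv}(g)(x)=\sup\{\varphi(x) : \varphi \text{ is convex}, \varphi\leq g\}$. *)

(* Defs.v *)
From mathcomp Require Import all_boot all_order all_algebra.
From mathcomp Require Import all_classical all_reals all_analysis.

Set Implicit Arguments.
Unset Strict Implicit.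
Unset Printing Implicit Defensive.

Import Order.TTheory GRing.Theory Num.Theory.
Import numFieldNormedType.Exports.

Local Open Scope classical_set_scope.
Local Open Scope ring_scope.

Definition dot (R : realType) (n : nat) (u v : 'rV[R]_n) : R :=
  \sum_(i < n) u 0 i * v 0 i.

(* The library norm of ['rV[R]_n] is the sup norm, hence the separate
   Euclidean norm and closed balls. *)
Definition enorm (R : realType) (n : nat) (u : 'rV[R]_n) : R :=
  Num.sqrt (dot u u).

Definition cball (R : realType) (n : nat) (x : 'rV[R]_n) (r : R) :
    set 'rV[R]_n :=
  [set y | enorm (y - x) <= r].

Definition lin_span (R : realType) (n : nat) (S : set 'rV[R]_n) :
    set 'rV[R]_n :=
  [set v | exists2 X : seq 'rV[R]_n, {in X, forall u, S u} & v \in <<X>>%VS].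

Definition grad (R : realType) (n : nat) (F : 'rV[R]_n -> R)
    (x : 'rV[R]_n) : 'rV[R]_n :=
  \row_(i < n) 'D_(delta_mx 0 i) F x.

Definition locally_lipschitz (R : realType) (n : nat)
    (H : 'rV[R]_n -> 'rV[R]_n) : Prop :=
  forall p : 'rV[R]_n, exists r L : R, 0 < r /\
    forall x y, cball p r x -> cball p r y ->
      enorm (H x - H y) <= L * enorm (x - y).

Definition C11loc (R : realType) (n : nat) (F : 'rV[R]_n -> R) : Prop :=
  (forall x, differentiable F x) /\ locally_lipschitz (grad F).

(* Functions on E are represented by total functions, of which only the
   values on E are used. *)
Definition convex_C11loc_extension (R : realType) (n : nat) (E : set 'rV[R]_n)
    (f : 'rV[R]_n -> R) (G : 'rV[R]_n -> 'rV[R]_n) (F : 'rV[R]_n -> R) : Prop :=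
  [/\ convex_function setT F, C11loc F,
      forall x, E x -> F x = f x & forall x, E x -> grad F x = G x].

Definition jet_condition (R : realType) (n : nat) (E : set 'rV[R]_n)
    (f : 'rV[R]_n -> R) (G : 'rV[R]_n -> 'rV[R]_n) (k : nat) (a : R) : Prop :=
  forall z y x, E z -> (E `&` cball 0 k%:R) y -> cball 0 (4 * k%:R) x ->
    f z + dot (G z) (x - z) <=
    f y + dot (G y) (x - y) + a / 2 * enorm (x - y) ^+ 2.

(* The envelope is taken in the extended reals, so that no default value of a
   real supremum intervenes. *)
Definition conv_env (R : realType) (n : nat) (g : 'rV[R]_n -> \bar R)
    (x : 'rV[R]_n) : \bar R :=
  ereal_sup [set (phi x)%:E | phi in
    [set phi : 'rV[R]_n -> R |
      convex_function setT phi /\ forall y, ((phi y)%:E <= g y)%E]].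

Lemma ex_pos_radius (R : realType) (n : nat) (y : 'rV[R]_n) :
  exists k : nat, (0 < k)%N && (y \in cball 0 k%:R).
Proof.
exists (Num.bound (enorm y)).+1; rewrite /=; apply/mem_set.
rewrite /cball /= subr0; apply/ltW; apply: lt_le_trans (_ : _ <= _).
  by apply: archi_boundP; rewrite sqrtr_ge0.
by rewrite ler_nat.
Qed.

Definition first_radius (R : realType) (n : nat) (y : 'rV[R]_n) : nat :=
  ex_minn (ex_pos_radius y).

Definition sup_norm_on (R : realType) (n : nat) (E : set 'rV[R]_n)
    (G : 'rV[R]_n -> 'rV[R]_n) : R :=
  sup [set enorm (G x) | x in E].

Definition inf_paraboloids (R : realType) (n : nat) (E : set 'rV[R]_n)
    (f : 'rV[R]_n -> R) (G : 'rV[R]_n -> 'rV[R]_n) (A : nat -> R)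
    (x : 'rV[R]_n) : \bar R :=
  ereal_inf [set (f y + dot (G y) (x - y) +
    2^-1 * (A (first_radius y) + 4 * sup_norm_on E G + 1)
      * enorm (x - y) ^+ 2)%:E | y in E].

(* Main.v *)
(* The minimal extension [m x = sup_z (f z + <G z, x - z>)] lies below a family of bumps
   [f y + <G y, x - y> + W y x], [y] in [E], each touching it at [y].  The infimum [g] of
   the bumps has locally bounded second differences, because near-minimizers at bounded
   [x] come from bounded [y].  The spanning hypothesis makes [g] coercive up to an affine
   function, so near-optimal convex combinations for [conv g] keep half of their mass in a
   ball; translating this half shows that [conv g] also has locally bounded second
   differences, which for a convex function means [C^{1,1}_loc].  Since [m <= conv g <= g],
   the 1-jet on [E] is the prescribed one.  For bounded [G] the bumps are the paraboloids
   of the formula; in general a locally finite sum of quartic ramps is added to make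
   [m <= g] hold far away.  Necessity is Taylor's formula on balls. *)
Require Import Defs.
From HB Require Import structures.
From mathcomp Require Import all_boot all_order all_algebra.
From mathcomp Require Import all_classical all_reals all_analysis.
From mathcomp Require Import ring lra zify.
Import Order.TTheory GRing.Theory Num.Theory.
Import numFieldNormedType.Exports.
Local Open Scope classical_set_scope.
Local Open Scope ring_scope.

Set Implicit Arguments.
Unset Strict Implicit.
Unset Printing Implicit Defensive.

(** * Euclidean geometry *)

Section Euclid.
Context {R : realType} {n : nat}.
Implicit Types u v w : 'rV[R]_n.

Lemma dotC u v : dot u v = dot v u.
Proof. by apply: eq_bigr => i _; rewrite mulrC. Qed.

Lemma dotDl u v w : dot (u + v) w = dot u w + dot v w.
Proof. by rewrite -big_split; apply: eq_bigr => i _; rewrite mxE mulrDl. Qed.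

Lemma dotZl a u v : dot (a *: u) v = a * dot u v.
Proof. by rewrite /dot mulr_sumr; apply: eq_bigr => i _; rewrite mxE mulrA. Qed.

Lemma dotDr u v w : dot u (v + w) = dot u v + dot u w.
Proof. by rewrite dotC dotDl !(dotC u). Qed.

Lemma dotZr a u v : dot u (a *: v) = a * dot u v.
Proof. by rewrite dotC dotZl dotC. Qed.

Lemma dotNl u v : dot (- u) v = - dot u v.
Proof. by rewrite -scaleN1r dotZl mulN1r. Qed.

Lemma dotNr u v : dot u (- v) = - dot u v.
Proof. by rewrite dotC dotNl dotC. Qed.

Lemma dotBl u v w : dot (u - v) w = dot u w - dot v w.
Proof. by rewrite dotDl dotNl. Qed.

Lemma dotBr u v w : dot u (v - w) = dot u v - dot u w.
Proof. by rewrite dotDr dotNr. Qed.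

Lemma dot0l v : dot 0 v = 0.
Proof. by rewrite -(scale0r 0) dotZl mul0r. Qed.

Lemma dot0r v : dot v 0 = 0.
Proof. by rewrite dotC dot0l. Qed.

Definition dotE := (dotDl, dotDr, dotZl, dotZr, dotNl, dotNr).

Lemma dot_sumr (I : Type) (r : seq I) (P : pred I) (F : I -> 'rV[R]_n) u :
  dot u (\sum_(i <- r | P i) F i) = \sum_(i <- r | P i) dot u (F i).
Proof. by apply: big_morph => [v w|]; [exact: dotDr | exact: dot0r]. Qed.

Lemma dot_delta u i : dot u (delta_mx 0 i) = u 0 i.
Proof.
rewrite /dot (bigD1 i)//= big1 ?addr0 => [|j /negPf ji].
  by rewrite mxE !eqxx mulr1.
by rewrite mxE eqxx ji mulr0.
Qed.

Lemma dot_ge0 u : 0 <= dot u u.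
Proof. by apply: sumr_ge0 => i _; rewrite -expr2 sqr_ge0. Qed.

Lemma enorm_ge0 u : 0 <= enorm u.
Proof. exact: sqrtr_ge0. Qed.

Lemma sqr_enorm u : enorm u ^+ 2 = dot u u.
Proof. by rewrite sqr_sqrtr ?dot_ge0. Qed.

Lemma enorm0 : enorm (0 : 'rV[R]_n) = 0.
Proof. by rewrite /enorm dot0l sqrtr0. Qed.

Lemma enormZ a u : enorm (a *: u) = `|a| * enorm u.
Proof.
by rewrite /enorm dotZl dotZr mulrA -expr2 sqrtrM ?sqr_ge0 // sqrtr_sqr.
Qed.

Lemma enormN u : enorm (- u) = enorm u.
Proof. by rewrite -scaleN1r enormZ normrN1 mul1r. Qed.

Lemma enormB u v : enorm (u - v) = enorm (v - u).
Proof. by rewrite -enormN opprB. Qed.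

Lemma enorm_eq0 u : enorm u = 0 -> u = 0.
Proof.
move=> u0; have := sqr_enorm u; rewrite u0 expr0n /= => /esym /eqP.
rewrite psumr_eq0 => [/allP h|i _]; last by rewrite -expr2 sqr_ge0.
apply/rowP => i; rewrite mxE; have := h i (mem_index_enum i).
by rewrite mulf_eq0 orbb => /eqP.
Qed.

(** Cauchy-Schwarz, from the nonnegative square of [dot v v *: u - dot u v *: v], which equals |v|^2
    (|u|^2 |v|^2 - <u, v>^2). *)
Lemma dot_le u v : dot u v <= enorm u * enorm v.
Proof.
have [v0|v0] := eqVneq (enorm v) 0.
  by rewrite (enorm_eq0 v0) dot0r enorm0 mulr0.
rewrite real_leNgt ?num_real //; apply/negP => h.
have vp : 0 < enorm v by rewrite lt_neqAle eq_sym v0 enorm_ge0.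
have := dot_ge0 (dot v v *: u - dot u v *: v).
have -> : dot (dot v v *: u - dot u v *: v) (dot v v *: u - dot u v *: v)
   = enorm v ^+ 2 * ((enorm u * enorm v) ^+ 2 - dot u v ^+ 2).
  by rewrite exprMn !sqr_enorm !dotE (dotC v u); ring.
rewrite pmulr_rge0 ?exprn_gt0 // subr_ge0 leNgt => /negP; apply.
by rewrite ltr_pXn2r // nnegrE ?mulr_ge0 ?enorm_ge0 //;
  apply: le_trans (ltW h); rewrite mulr_ge0 ?enorm_ge0.
Qed.

Lemma norm_dot_le u v : `|dot u v| <= enorm u * enorm v.
Proof. by rewrite ler_norml dot_le andbT lerNl -dotNl -(enormN u) dot_le. Qed.

Lemma enorm_add u v : enorm (u + v) <= enorm u + enorm v.
Proof.
rewrite -(@ler_pXn2r _ 2) // ?nnegrE ?addr_ge0 ?enorm_ge0 //.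
rewrite sqr_enorm !dotE (dotC v u) sqrrD !sqr_enorm.
have := dot_le u v; lra.
Qed.

Lemma enorm_triangle w u v : enorm (u - v) <= enorm (u - w) + enorm (w - v).
Proof. by rewrite -{1}(subrK w u) -addrA enorm_add. Qed.

Lemma enorm_sub_le u v : enorm (u - v) <= enorm u + enorm v.
Proof. by rewrite -(enormN v) enorm_add. Qed.

Lemma enorm_le_sum u : enorm u <= \sum_(i < n) `|u 0 i|.
Proof.
rewrite -(@ler_pXn2r _ 2) // ?nnegrE ?enorm_ge0 ?sumr_ge0 //.
rewrite sqr_enorm expr2 mulr_suml; apply: ler_sum => i _.
apply: le_trans (ler_norm _) _; rewrite normrM ler_wpM2l //.
by rewrite (bigD1 i) //= lerDl sumr_ge0.
Qed.

Lemma norm_coord_le u i : `|u 0 i| <= enorm u.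
Proof.
rewrite -(@ler_pXn2r _ 2) // ?nnegrE ?enorm_ge0 // sqr_enorm real_normK ?num_real //.
rewrite /dot (bigD1 i) //= -expr2 lerDl sumr_ge0 // => j _.
by rewrite -expr2 sqr_ge0.
Qed.

Lemma enorm_le_normr u : enorm u <= n%:R * `|u|.
Proof.
apply: le_trans (enorm_le_sum u) _.
rewrite mulr_natl -[X in _ *+ X](card_ord n) -sumr_const.
apply: ler_sum => i _.
rewrite [leRHS]/Num.norm /= mx_normrE.
by apply/bigmax_geP; right => /=; exists (0, i).
Qed.

Lemma delta_decomp u : u = \sum_(i < n) u 0 i *: delta_mx 0 i.
Proof. exact: row_sum_delta. Qed.

(** Testing with [h = t *: u] gives t |u|^2 <= C t^2 |u|^2, impossible for u != 0 once C t < 1. This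
    identifies the gradient of the extension on [E]. *)
Lemma dot_quadratic_eq0 u C :
  (forall h, enorm h <= 1 -> dot u h <= C * enorm h ^+ 2) -> u = 0.
Proof.
move=> H; apply: enorm_eq0; apply/eqP; rewrite eq_le enorm_ge0 andbT.
rewrite leNgt; apply/negP => up.
have Cp : 0 < `|C| + enorm u + 1 by have := normr_ge0 C; lra.
set t := (`|C| + enorm u + 1)^-1.
have tp : 0 < t by rewrite invr_gt0.
have tC : t * (`|C| + enorm u + 1) = 1 by rewrite mulVf // gt_eqF.
have Cle := ler_norm C; have C0 := normr_ge0 C.
have tu : t * enorm u <= 1 by nra.
have := H (t *: u); rewrite enormZ gtr0_norm // => /(_ tu).
rewrite dotZr -sqr_enorm exprMn.
have -> : C * (t ^+ 2 * enorm u ^+ 2) = t * (enorm u ^+ 2) * (C * t) by ring.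
rewrite -[leLHS]mulr1 ler_pM2l ?mulr_gt0 ?exprn_gt0 //; nra.
Qed.

End Euclid.

(** * Convex hull of a function *)

Section Hull.
Context {R : realType} {n : nat}.
Implicit Types (s : seq (R * 'rV[R]_n)) (g phi : 'rV[R]_n -> R) (x y : 'rV[R]_n).

Lemma convex_functionTP g : convex_function setT g <->
  forall t x y, 0 <= t <= 1 -> g (t *: x + (1 - t) *: y) <= t * g x + (1 - t) * g y.
Proof.
split=> [cg t x y t01|cg t x y _ _]; last first.
  exact: (cg t%:num x y (andb_true_intro (conj (ge0 t) (le1 t)))).
have /andP[t0 t1] := t01.
pose p : {i01 R} := Itv01 t0 t1.
exact: (cg p x y (in_setT _) (in_setT _)).
Qed.

(** Convex combinations are lists of weighted points; repetitions and zero weights are harmless, so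
    lists can be concatenated and individual points moved. *)
Definition mass s := \sum_(q <- s) q.1.
Definition bary s := \sum_(q <- s) q.1 *: q.2.
Definition avg g s := \sum_(q <- s) q.1 * g q.2.
Definition combo x s : Prop :=
  [/\ {in s, forall q, 0 <= q.1}, mass s = 1 & bary s = x].

Lemma avg_le g phi s : {in s, forall q, 0 <= q.1} ->
  {in s, forall q, g q.2 <= phi q.2} -> avg g s <= avg phi s.
Proof.
move=> s0 gphi; rewrite /avg big_seq [leRHS]big_seq; apply: ler_sum => q qs.
by rewrite ler_wpM2l ?s0 ?gphi.
Qed.

Lemma combo_affine x s c p : combo x s ->
  avg (fun y => c + dot p y) s = c + dot p x.
Proof.
move=> [_ s1 <-]; rewrite /avg /bary dot_sumr -[X in X + _]mul1r -s1 mulr_suml.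
by rewrite -big_split; apply: eq_bigr => q _; rewrite dotZr mulrDr.
Qed.

(* The spare point [(a, x)] absorbs the points of [s] one by one, which avoids normalizing
   the weights of the tail of [s]. *)
Lemma jensen_aux phi s a x :
  convex_function setT phi -> {in s, forall q, 0 <= q.1} -> 0 <= a ->
  mass s + a = 1 -> phi (bary s + a *: x) <= avg phi s + a * phi x.
Proof.
move=> /convex_functionTP cphi.
elim: s a x => [|q s IH] a x s0 a0; rewrite /mass /bary /avg ?big_nil ?big_cons.
  by rewrite !add0r => ->; rewrite scale1r mul1r.
have q0 : 0 <= q.1 by apply: s0; rewrite mem_head.
have {}s0 : {in s, forall q, 0 <= q.1} by move=> r rs; apply: s0; rewrite in_cons rs orbT.
rewrite -/(mass s) -/(bary s) -/(avg phi s) => sa1.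
have [qa|qa] := eqVneq (q.1 + a) 0.
  have q10 : q.1 = 0 by lra.
  have a10 : a = 0 by lra.
  have := IH 0 x s0 (lexx _).
  by rewrite q10 a10 !scale0r !mul0r !addr0 !add0r; apply; lra.
have qap : 0 < q.1 + a by rewrite lt_neqAle eq_sym qa addr_ge0.
set y := (q.1 / (q.1 + a)) *: q.2 + (1 - q.1 / (q.1 + a)) *: x.
have ya : (q.1 + a) *: y = q.1 *: q.2 + a *: x.
  by rewrite scalerDr !scalerA mulrBr mulrCA divff // !mulr1 addrAC subrr add0r.
have -> : q.1 *: q.2 + bary s + a *: x = bary s + (q.1 + a) *: y.
  by rewrite ya addrA (addrC (bary s)).
apply: le_trans (IH (q.1 + a) y s0 (ltW qap) _) _; first by lra.
suff : (q.1 + a) * phi y <= q.1 * phi q.2 + a * phi x by lra.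
have := cphi (q.1 / (q.1 + a)) q.2 x.
rewrite divr_ge0 ?(ltW qap) //= ler_pdivrMr // mul1r lerDl a0 => /(_ isT).
rewrite -/y -(ler_pM2l qap) => /le_trans; apply.
by rewrite le_eqVlt; apply/orP; left; apply/eqP; field.
Qed.

Lemma jensen phi s x : convex_function setT phi -> combo x s -> phi x <= avg phi s.
Proof.
move=> cphi [s0 s1 <-]; have := @jensen_aux phi s 0 0 cphi s0 (lexx _).
by rewrite scale0r mul0r !addr0; apply.
Qed.

(** The convex envelope as an infimum of averages, whose near-optimal combinations can be perturbed.
    An affine minorant of [g] makes the real [inf] meaningful. *)
Definition hull g x := inf [set avg g s | s in combo x].

Lemma combo1 x : combo x [:: (1, x)].
Proof.
split=> [q||]; first by rewrite inE => /eqP->.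
- by rewrite /mass big_seq1.
- by rewrite /bary big_seq1 scale1r.
Qed.

Lemma combo_cat (t : R) x y s s' : 0 <= t <= 1 -> combo x s -> combo y s' ->
  let u := [seq (t * q.1, q.2) | q <- s] ++ [seq ((1 - t) * q.1, q.2) | q <- s'] in
  combo (t *: x + (1 - t) *: y) u /\
  forall g, avg g u = t * avg g s + (1 - t) * avg g s'.
Proof.
move=> /andP[t0 t1] [s0 s1 <-] [s'0 s'1 <-] u; split=> [|g].
  split.
  - move=> q; rewrite mem_cat => /orP[] /mapP[r rs ->] /=.
      by rewrite mulr_ge0 ?s0.
    by rewrite mulr_ge0 ?s'0 ?subr_ge0.
  - rewrite /mass /u big_cat !big_map /= -!mulr_sumr.
    by move: s1 s'1; rewrite /mass => -> ->; rewrite !mulr1 addrC subrK.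
  - rewrite /bary /u big_cat !big_map /= !scaler_sumr.
    by congr (_ + _); apply: eq_bigr => q _; rewrite scalerA.
rewrite /avg /u big_cat !big_map /= !mulr_sumr.
by congr (_ + _); apply: eq_bigr => q _; rewrite mulrA.
Qed.

(** * Envelope of a function with an affine minorant *)

Section Bounded.
Variables (g : 'rV[R]_n -> R) (c : R) (p : 'rV[R]_n).
Hypothesis gge : forall x, c + dot p x <= g x.

Lemma avg_ge_affine x s : combo x s -> c + dot p x <= avg g s.
Proof.
move=> sx; rewrite -(@combo_affine _ _ c p sx); have [s0 _ _] := sx.
exact: avg_le.
Qed.

Lemma hull_has_inf x : has_inf [set avg g s | s in combo x].
Proof.
split; first by exists (avg g [:: (1, x)]), [:: (1, x)] => //; exact: combo1.
by exists (c + dot p x) => _ [s sx <-]; exact: avg_ge_affine.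
Qed.

Lemma hull_le_avg x s : combo x s -> hull g x <= avg g s.
Proof. by move=> sx; apply: (ge_inf (hull_has_inf x).2); exists s. Qed.

Lemma hull_le x : hull g x <= g x.
Proof.
by apply: le_trans (hull_le_avg (combo1 x)) _; rewrite /avg big_seq1 mul1r.
Qed.

Lemma hull_adherent x e : 0 < e -> exists2 s, combo x s & avg g s < hull g x + e.
Proof.
by move=> e0; have [_ [s sx <-] h] := inf_adherent e0 (hull_has_inf x); exists s.
Qed.

Lemma hull_convex : convex_function setT (hull g).
Proof.
apply/convex_functionTP => t x y t01; apply/ler_addgt0Pr => e e0.
have [s sx hs] := hull_adherent x e0; have [s' sy hs'] := hull_adherent y e0.
have [uc ue] := combo_cat t01 sx sy.
apply: le_trans (hull_le_avg uc) _; rewrite ue.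
move/andP: t01 => [t0 t1].
have := ler_wpM2l t0 (ltW hs).
have := @ler_wpM2l _ (1 - t) _ _ _ (ltW hs'); rewrite subr_ge0 => /(_ t1).
by lra.
Qed.

Lemma le_hull phi : convex_function setT phi -> (forall x, phi x <= g x) ->
  forall x, phi x <= hull g x.
Proof.
move=> cphi le x; apply: lb_le_inf; first exact: (hull_has_inf x).1.
move=> _ [s sx <-]; apply: le_trans (jensen cphi sx) _.
by have [s0 _ _] := sx; apply: avg_le.
Qed.

(** [hull g] is itself a convex minorant of [g], and by Jensen's inequality it dominates every other
    one. *)
Lemma hull_conv_env x : (hull g x)%:E = conv_env (fun y => (g y)%:E) x.
Proof.
apply/eqP; rewrite eq_le; apply/andP; split.
  apply: ereal_sup_ubound; exists (hull g) => //; split; first exact: hull_convex.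
  by move=> y; rewrite lee_fin hull_le.
apply: ge_ereal_sup => _ [phi [cphi le] <-]; rewrite lee_fin; exact: le_hull.
Qed.

End Bounded.

Lemma convex_affine c p : convex_function setT (fun x : 'rV[R]_n => c + dot p x).
Proof.
apply/convex_functionTP => t x y _; rewrite dotDr !dotZr.
by rewrite le_eqVlt; apply/orP; left; apply/eqP; ring.
Qed.

End Hull.

(** * Second differences of the convex hull *)

Section SemiconcaveHull.
Context {R : realType} {n : nat}.
Implicit Types (s : seq (R * 'rV[R]_n)) (g phi : 'rV[R]_n -> R) (x y : 'rV[R]_n).

Lemma avgD g phi s : avg (fun y => g y + phi y) s = avg g s + avg phi s.
Proof. by rewrite /avg -big_split; apply: eq_bigr => q _; rewrite mulrDr. Qed.

Lemma avgZ a g s : avg (fun y => a * g y) s = a * avg g s.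
Proof. by rewrite /avg mulr_sumr; apply: eq_bigr => q _; rewrite mulrCA. Qed.

Lemma avg_sum (I : Type) (r : seq I) (F : I -> 'rV[R]_n -> R) s :
  avg (fun y => \sum_(i <- r) F i y) s = \sum_(i <- r) avg (F i) s.
Proof.
by rewrite /avg exchange_big; apply: eq_bigr => q _; rewrite mulr_sumr.
Qed.

(* Coercivity of [g] in the direction [w], in an averaged form that is stable under linear
   combinations of directions. *)
Definition controlled g (w : 'rV[R]_n) := forall r M, exists C, forall x s,
  enorm x <= r -> combo x s -> avg g s <= M -> avg (fun y => `|dot w y|) s <= C.

Lemma controlled0 g : controlled g 0.
Proof.
move=> r M; exists 0 => x s _ _ _; rewrite /avg big1 // => q _.
by rewrite dot0l normr0 mulr0.
Qed.

Lemma controlledZD g a u v :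
  controlled g u -> controlled g v -> controlled g (a *: u + v).
Proof.
move=> Pu Pv r M; have [C hC] := Pu r M; have [D hD] := Pv r M.
exists (`|a| * C + D) => x s xr sx gM; have [s0 _ _] := sx.
apply: (@le_trans _ _ (avg (fun y => `|a| * `|dot u y| + `|dot v y|) s)).
  by apply: avg_le => // q _; rewrite dotDl dotZl -normrM ler_normD.
by rewrite avgD avgZ lerD ?ler_wpM2l ?(hC x) ?(hD x).
Qed.

(** Two affine minorants of slopes [p] and [q] bound |<p - q, y>| by 2 g(y) plus an affine function
    of y, and affine functions average to their value at the barycenter. *)
Lemma controlled_slopes g c d p q : (forall x, c + dot p x <= g x) ->
  (forall x, d + dot q x <= g x) -> controlled g (p - q).
Proof.
move=> gp gq r M; exists (2 * M + (2 * (`|c| + `|d|) + enorm (p + q) * r)) => x s xr sx gM.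
have [s0 _ _] := sx.
apply: (@le_trans _ _ (avg (fun y => 2 * g y + (2 * (`|c| + `|d|) + dot (- (p + q)) y)) s)).
  apply: avg_le => // u _ ; have := gp u.2; have := gq u.2.
  have := ler_norm (- c); have := ler_norm (- d).
  have := normr_ge0 c; have := normr_ge0 d; rewrite !normrN.
  by rewrite dotBl dotNl dotDl ler_norml => h1 h2 h3 h4 h5 h6; apply/andP; split; lra.
rewrite avgD avgZ (combo_affine _ _ sx) dotNl.
have := norm_dot_le (p + q) x; rewrite ler_norml => /andP[h _].
by have := ler_wpM2l (enorm_ge0 (p + q)) xr; lra.
Qed.

Lemma controlled_span g (S : set 'rV[R]_n) :
  (forall w, S w -> controlled g w) -> lin_span S `<=` controlled g.
Proof.
move=> PS v [X XS vX]; rewrite (coord_span (X := in_tuple X) vX).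
elim/big_ind: _ => [|u w Pu Pw|i _].
- exact: controlled0.
- by rewrite -(scale1r u); apply: controlledZD.
- rewrite -[X in controlled _ X]addr0; apply: controlledZD (@controlled0 g).
  by apply/PS/XS/mem_nth.
Qed.

Lemma controlled_enorm g : (forall w, controlled g w) -> forall r M, exists C, forall x s,
  enorm x <= r -> combo x s -> avg g s <= M -> avg (@enorm R n) s <= C.
Proof.
move=> P r M; have [C hC] := choice (fun i : 'I_n => P (delta_mx 0 i) r M).
exists (\sum_i C i) => x s xr sx gM; have [s0 _ _] := sx.
apply: (@le_trans _ _ (avg (fun y => \sum_i `|dot (delta_mx 0 i) y|) s)).
  apply: avg_le => // q _; apply: le_trans (enorm_le_sum _) _.
  by apply: ler_sum => i _; rewrite dotC dot_delta.
by rewrite avg_sum; apply: ler_sum => i _; apply: (hC i x).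
Qed.

(** The bound [d] on the step is explicit because passing to the hull costs a factor 2: steps up to
    2 for [g] give steps up to 1 for [hull g]. *)
Definition locally_semiconcave (d : R) g := forall r, exists C, forall x h,
  enorm x <= r -> enorm h <= d -> g (x + h) + g (x - h) <= 2 * g x + C * enorm h ^+ 2.

Definition locally_bounded_above g := forall r, exists M, forall x,
  enorm x <= r -> g x <= M.

Definition near_mass (r : R) s := \sum_(q <- s | enorm q.2 <= r) q.1.
Definition shift_near (r : R) v s : seq (R * 'rV[R]_n) :=
  [seq (q.1, if enorm q.2 <= r then q.2 + v else q.2) | q <- s].

Lemma combo_shift_near r v x s : combo x s ->
  combo (x + near_mass r s *: v) (shift_near r v s).
Proof.
move=> [s0 s1 sx]; split.
- by move=> _ /mapP[q qs ->] /=; exact: s0.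
- by rewrite /mass big_map.
- rewrite /bary big_map /= /near_mass scaler_suml -sx /bary.
  rewrite [X in _ = _ + X]big_mkcond -big_split.
  by apply: eq_bigr => q _ /=; case: ifP => _; rewrite ?scalerDr ?addr0.
Qed.

(** Markov's inequality: the weight outside the ball of radius [r] is at most C / r <= 1 / 2. *)
Lemma near_mass_ge (r : R) s C : 0 < r -> {in s, forall q, 0 <= q.1} -> mass s = 1 ->
  avg (@enorm R n) s <= C -> 2 * C <= r -> 1 / 2 <= near_mass r s.
Proof.
move=> r0 s0 s1 sC Cr; rewrite /mass (bigID (fun q => enorm q.2 <= r)) /= in s1.
rewrite /near_mass; suff : \sum_(q <- s | ~~ (enorm q.2 <= r)) q.1 <= 1 / 2 by lra.
rewrite -(ler_pM2l r0); apply: le_trans (_ : C <= _); last lra.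
apply: le_trans sC; rewrite mulr_sumr /avg big_mkcond big_seq [leRHS]big_seq.
apply: ler_sum => q qs; rewrite -ltNge; case: ifP => [h|_].
  by rewrite mulrC ler_wpM2l ?s0 ?ltW.
by rewrite mulr_ge0 ?s0 ?enorm_ge0.
Qed.

(* Near-optimal convex combinations for [hull g x] keep at least half of their mass in
   a fixed ball; moving that part by [h / near_mass] moves the barycenter by [h]. *)
Lemma hull_semiconcave g c p : (forall x, c + dot p x <= g x) ->
  (forall w, controlled g w) -> locally_bounded_above g ->
  locally_semiconcave 2 g -> locally_semiconcave 1 (hull g).
Proof.
move=> gp /controlled_enorm gc gb gs r.
have [M gM] := gb r; have [C1 hC1] := gc r (M + 1).
pose r2 := 2 * `|C1| + 1.
have r20 : 0 < r2 by rewrite /r2; have := normr_ge0 C1; lra.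
have [C2 hC2] := gs r2; exists (2 * `|C2|) => x h xr h1.
(* The tolerance [e] is at most 1, so that the radius [r2], obtained from the level [M + 1], serves
   for every [e]. *)
suff H e : 0 < e <= 1 -> hull g (x + h) + hull g (x - h)
   <= 2 * hull g x + 2 * `|C2| * enorm h ^+ 2 + 2 * e.
  apply/ler_addgt0Pr => e e0.
  have m0 : 0 < Num.min (e / 2) 1 <= 1.
    by rewrite lt_min ltr01 andbT divr_gt0 // ge_min lexx orbT.
  apply: le_trans (H _ m0) _; rewrite lerD2l.
  have : Num.min (e / 2) 1 <= e / 2 by rewrite ge_min lexx.
  by lra.
move=> /andP[e0 e1]; have [s sx /ltW hs] := hull_adherent gp x e0.
have [s0 s1 _] := sx.
have sM : avg g s <= M + 1.
  by apply: le_trans hs _; rewrite lerD // (le_trans (hull_le gp x)) ?gM.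
have m12 := near_mass_ge r20 s0 s1 (hC1 x s xr sx sM) _.
have {}m12 : 1 / 2 <= near_mass r2 s.
  by apply: m12; rewrite /r2; have := ler_norm C1; lra.
set m := near_mass r2 s in m12; have m0 : 0 < m by lra.
have mu : m \is a GRing.unit by rewrite unitfE gt_eqF.
have im : m^-1 <= 2 by rewrite -[leRHS]invrK lef_pV2 ?posrE //; lra.
have im0 : 0 < m^-1 by rewrite invr_gt0.
pose v := m^-1 *: h.
have mv : m *: v = h by rewrite scalerA divrr // scale1r.
have v2 : enorm v <= 2.
  rewrite enormZ gtr0_norm //; have := enorm_ge0 h; nra.
have := hull_le_avg gp (combo_shift_near r2 v sx).
have := hull_le_avg gp (combo_shift_near r2 (- v) sx).
rewrite -/m scalerN mv => Hm Hp.
(* Each point in the ball contributes a second difference of [g] with step [v]; the other points do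
   not move. *)
have key : avg g (shift_near r2 v s) + avg g (shift_near r2 (- v) s)
    <= 2 * avg g s + m * (`|C2| * enorm v ^+ 2).
  rewrite /avg !big_map /= -big_split mulr_sumr /m /near_mass mulr_suml.
  rewrite [X in _ <= _ + X]big_mkcond -big_split big_seq [leRHS]big_seq.
  apply: ler_sum => q qs /=; case: ifP => hq; last by rewrite addr0; lra.
  have := hC2 q.2 v hq v2.
  have := ler_wpM2r (sqr_ge0 (enorm v)) (ler_norm C2) => A B.
  have := ler_wpM2l (s0 q qs) (le_trans B (lerD (lexx _) A)).
  by rewrite !mulrDr; lra.
(* m |v|^2 = |h|^2 / m, and 1 / m <= 2. *)
have vh : m * (`|C2| * enorm v ^+ 2) <= 2 * `|C2| * enorm h ^+ 2.
  rewrite enormZ (gtr0_norm im0) exprMn.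
  have -> : m * (`|C2| * (m^-1 ^+ 2 * enorm h ^+ 2)) =
      m^-1 * (`|C2| * enorm h ^+ 2) by field; rewrite gt_eqF.
  by rewrite -mulrA ler_wpM2r // mulr_ge0 // sqr_ge0.
lra.
Qed.

End SemiconcaveHull.

(** * Differentiability from a quadratic error *)

Lemma differentiable_of_near (R : realType) (V W : normedModType R) (f : V -> W)
    (df : {linear V -> W}) (x : V) : continuous df ->
  (forall e : R, 0 < e ->
    \forall h \near (0 : V), `|f (h + x) - f x - df h| <= e * `|h|) ->
  differentiable f x /\ 'd f x = df :> (V -> W).
Proof.
move=> cdf H; have D : f \o shift x = cst (f x) + df +o_ 0 id.
  apply/eqaddoP => e /H; apply: filterS => h.
  by rewrite /= !fctE /= opprD addrA.
have dE := diff_unique cdf D; split => //.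
by apply/diff_locallyP; rewrite dE.
Qed.

Section Differential.
Context {R : realType} {n : nat}.
Implicit Types (F : 'rV[R]_n -> R) (x y h u v : 'rV[R]_n).

Lemma dot_linear u : linear (dot u : 'rV[R]_n -> R^o).
Proof. by move=> a v w; rewrite dotDr dotZr. Qed.

HB.instance Definition _ u :=
  GRing.isLinear.Build R 'rV[R]_n R^o *:%R (dot u) (dot_linear u).

Lemma near_enorm (e : R) : 0 < e -> \forall h \near (0 : 'rV[R]_n), enorm h <= e.
Proof.
(* The Euclidean norm is at most n times the sup norm; n + 1 stays positive when n = 0. *)
move=> e0; have n1 : 0 < n%:R + 1 :> R by rewrite ltr_pwDr.
near=> h; apply: le_trans (enorm_le_normr h) _.
have h1 : `|h| <= e / (n%:R + 1).
  by near: h; apply: (@nbhs0_le R 'rV[R]_n); rewrite divr_gt0.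
apply: le_trans (ler_wpM2l _ h1) _ => //.
rewrite mulrCA -[leRHS]mulr1 ler_wpM2l //; first exact: ltW.
by rewrite ler_pdivrMr // mul1r lerDl.
Unshelve. all: by end_near. Qed.

Lemma dot_continuous u : continuous (dot u : 'rV[R]_n -> R^o).
Proof.
apply/linear_bounded_continuous/ex_bound; exists (enorm u).
near=> v; apply: le_trans (norm_dot_le u v) _.
by rewrite -[leRHS]mulr1 ler_wpM2l ?enorm_ge0 //; near: v; exact: near_enorm.
Unshelve. all: by end_near. Qed.

Lemma differentiable_grad F x v : differentiable F x -> 'D_v F x = dot (grad F x) v.
Proof.
move=> dF; rewrite deriveE // {1}(delta_decomp v) linear_sum.
by apply: eq_bigr => i _; rewrite linearZ mxE deriveE // mulrC.
Qed.

Lemma grad_quadratic F x u C :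
  (forall h, enorm h <= 1 -> `|F (x + h) - F x - dot u h| <= C * enorm h ^+ 2) ->
  differentiable F x /\ grad F x = u.
Proof.
move=> H.
pose L : {linear 'rV[R]_n -> R^o} := dot u.
have [||dF dE] := @differentiable_of_near R 'rV[R]_n R^o F L x.
- exact: dot_continuous.
- move=> e e0.
  (* As |h| is at most n times the sup norm, the error is at most |C| n |h| times the sup norm, and
     |h| <= e / K turns this factor into [e]. *)
  pose K := `|C| * n%:R + 1.
  have K0 : 0 < K by rewrite ltr_pwDr // mulr_ge0.
  near=> h; rewrite /= [h + x]addrC.
  have h1 : enorm h <= e / K by near: h; apply: near_enorm; rewrite divr_gt0.
  have h2 : enorm h <= 1 by near: h; exact: near_enorm.
  apply: le_trans (H h h2) _.
  have nh := enorm_le_normr h; have h0 := enorm_ge0 h.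
  apply: (@le_trans _ _ (`|C| * n%:R * enorm h * `|h|)).
    apply: le_trans (ler_wpM2r (sqr_ge0 _) (ler_norm C)) _.
    by have := ler_wpM2l (normr_ge0 C) (ler_wpM2l h0 nh); lra.
  rewrite ler_wpM2r //; apply: (@le_trans _ _ (K * enorm h)).
    by rewrite ler_wpM2r // lerDl.
  by rewrite mulrC -ler_pdivlMr.
by split => //; apply/rowP => i; rewrite mxE deriveE // dE -[RHS]dot_delta.
Unshelve. all: by end_near. Qed.

End Differential.

(** * Convex functions with bounded second differences *)

Section ConvexSemiconcave.
Context {R : realType} {n : nat}.
Variable F : 'rV[R]_n -> R.
Hypothesis cF : convex_function setT F.
Implicit Types (x y h u v : 'rV[R]_n).

Let cvx (t : R) x y : 0 <= t <= 1 ->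
  F (t *: x + (1 - t) *: y) <= t * F x + (1 - t) * F y.
Proof. by move=> t01; exact: (convex_functionTP F).1. Qed.

Let quot x h (t : R) := (F (x + t *: h) - F x) / t.

Lemma quot_mono x h s t : 0 < s -> s <= t -> quot x h s <= quot x h t.
Proof.
move=> s0 st; have t0 := lt_le_trans s0 st.
have := @cvx (s / t) (x + t *: h) x.
rewrite divr_ge0 ?(ltW s0) ?(ltW t0) //= ler_pdivrMr // mul1r st => /(_ isT).
have -> : (s / t) *: (x + t *: h) + (1 - s / t) *: x = x + s *: h.
  rewrite scalerDr scalerA divfK ?gt_eqF // addrAC -scalerDl.
  by rewrite addrC [_ - _]addrC addrA subrr add0r scale1r addrC.
move=> H; rewrite /quot ler_pdivrMr // -mulrA [t^-1 * s]mulrC; lra.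
Qed.

(** [x] is the convex combination of [x + t *: h] and [x - h] with weights 1/(1+t) and t/(1+t), so a
    backward slope bounds all forward slopes from below. *)
Lemma quot_ge x h t : 0 < t -> F x - F (x - h) <= quot x h t.
Proof.
move=> t0; have t1 : 0 < 1 + t by lra.
have := @cvx (1 + t)^-1 (x + t *: h) (x - h).
rewrite invr_ge0 (ltW t1) /= invf_le1 // lerDl (ltW t0) => /(_ isT).
have -> : (1 + t)^-1 *: (x + t *: h) + (1 - (1 + t)^-1) *: (x - h) = x.
  apply/rowP => i; rewrite !mxE; field; lra.
rewrite -(ler_pM2l t1) mulrDr !mulrA mulrBr divff ?gt_eqF // mulr1 mul1r => H.
by rewrite /quot ler_pdivlMr //; lra.
Qed.

(** The one-sided directional derivative: slopes increase with t, so the limit at 0+ is an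
    infimum. *)
Definition dirder x h := inf [set quot x h t | t in [set t : R | 0 < t]].

Lemma dirder_has_inf x h : has_inf [set quot x h t | t in [set t : R | 0 < t]].
Proof.
split; first by exists (quot x h 1), 1 => //=.
by exists (F x - F (x - h)) => _ [t t0 <-]; exact: quot_ge.
Qed.

Lemma dirder_le x h t : 0 < t -> dirder x h <= quot x h t.
Proof. by move=> t0; apply: (ge_inf (dirder_has_inf x h).2); exists t. Qed.

Lemma le_dirder x h b : (forall t, 0 < t -> b <= quot x h t) -> b <= dirder x h.
Proof.
move=> H; apply: lb_le_inf (dirder_has_inf x h).1 _.
by move=> _ [t t0 <-]; exact: H.
Qed.

Lemma dirder_ge x h : F x - F (x - h) <= dirder x h.
Proof. by apply: le_dirder => t; exact: quot_ge. Qed.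

Lemma dirder0 x : dirder x 0 = 0.
Proof.
apply/eqP; rewrite eq_le; apply/andP; split.
  apply: le_trans (dirder_le x 0 ltr01) _.
  by rewrite /quot scaler0 addr0 subrr mul0r.
by have := dirder_ge x 0; rewrite subr0 subrr.
Qed.

(** [x + (m / 2) *: (a + b)] is the midpoint of [x + m *: a] and [x + m *: b]. The steps [s] and [t]
    are independent so that the two infima can be taken in turn. *)
Lemma dirderD x a b : dirder x (a + b) <= dirder x a + dirder x b.
Proof.
have H s t : 0 < s -> 0 < t -> dirder x (a + b) <= quot x a s + quot x b t.
  move=> s0 t0; set m := Num.min s t.
  have m0 : 0 < m by rewrite lt_min s0.
  have m2 : 0 < m / 2 by rewrite divr_gt0.
  apply: le_trans (dirder_le x (a + b) m2) _.
  apply: (@le_trans _ _ (quot x a m + quot x b m)); last first.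
    by rewrite lerD // quot_mono // ge_min lexx ?orbT.
  have := @cvx (1 / 2) (x + m *: a) (x + m *: b).
  have -> : (1 / 2) *: (x + m *: a) + (1 - 1 / 2) *: (x + m *: b) = x + (m / 2) *: (a + b).
    by apply/rowP => i; rewrite !mxE; field.
  have h12 : (0 <= 1 / 2 :> R) && (1 / 2 <= 1 :> R) by apply/andP; split; lra.
  move=> /(_ h12) h; rewrite /quot -mulrDl ler_pdivrMr // -mulrA.
  have -> : m^-1 * (m / 2) = 1 / 2 by field; rewrite gt_eqF.
  lra.
rewrite -lerBlDr; apply: le_dirder => s s0; rewrite lerBlDr [leRHS]addrC -lerBlDr.
by apply: le_dirder => t t0; rewrite lerBlDr [leRHS]addrC H.
Qed.

Lemma dirderZ x k h : 0 < k -> dirder x (k *: h) <= k * dirder x h.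
Proof.
move=> k0; rewrite -ler_pdivrMl //; apply: le_dirder => t t0.
rewrite ler_pdivrMl //; apply: le_trans (dirder_le x (k *: h) (divr_gt0 t0 k0)) _.
rewrite /quot scalerA divfK ?gt_eqF // invf_div mulrCA.
by rewrite mulrC -mulrA.
Qed.

Hypothesis sF : locally_semiconcave 1 F.

(** The slopes along h and -h with step t add up to a second difference over t, at most C t |h|^2,
    which tends to 0. This makes the sublinear [dirder x] linear. *)
Lemma dirderN x h : dirder x (- h) <= - dirder x h.
Proof.
have [C hC] := sF (enorm x).
rewrite -subr_le0 opprK; apply/ler_addgt0Pr => e e0; rewrite add0r.
pose K := `|C| * enorm h ^+ 2 + 1.
have K0 : 0 < K by rewrite ltr_pwDr // mulr_ge0 // sqr_ge0.
have h0 : 0 < enorm h + 1 by rewrite ltr_pwDr // enorm_ge0.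
pose t := Num.min (e / K) (enorm h + 1)^-1.
have t0 : 0 < t by rewrite lt_min divr_gt0 //= invr_gt0.
have tK : t * K <= e by rewrite -ler_pdivlMr // ge_min lexx.
have th : enorm (t *: h) <= 1.
  rewrite enormZ gtr0_norm //; apply: (@le_trans _ _ (t * (enorm h + 1))).
    by rewrite ler_wpM2l ?(ltW t0) // lerDl.
  by rewrite -ler_pdivlMr // mul1r ge_min lexx orbT.
have := hC x (t *: h) (lexx _) th; rewrite enormZ (gtr0_norm t0) exprMn => H.
apply: le_trans (lerD (dirder_le _ _ t0) (dirder_le _ _ t0)) _.
rewrite /quot -mulrDl ler_pdivrMr // scalerN.
apply: (@le_trans _ _ (t * K * t)); last by rewrite ler_wpM2r // ltW.
have := ler_wpM2r (mulr_ge0 (sqr_ge0 t) (sqr_ge0 (enorm h))) (ler_norm C).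
have := sqr_ge0 t; rewrite /K; lra.
Qed.

Definition subgrad x : 'rV[R]_n := \row_i dirder x (delta_mx 0 i).

(** Subadditivity reduces to the coordinate directions; a negative coordinate is handled by
    [dirderN]. *)
Lemma dirder_le_subgrad x h : dirder x h <= dot (subgrad x) h.
Proof.
rewrite {1}(delta_decomp h) /dot.
elim/big_ind2 : _ => [|a a' b b' ha hb|i _]; first by rewrite dirder0.
  exact: le_trans (dirderD _ _ _) (lerD ha hb).
rewrite mxE; case: (ltrgt0P (h 0 i)) => [h0|h0|->].
- by rewrite mulrC dirderZ.
- have h0' : 0 < - h 0 i by rewrite oppr_gt0.
  have -> : h 0 i *: delta_mx 0 i = (- h 0 i) *: - delta_mx 0 i :> 'rV[R]_n.
    by rewrite scaleNr scalerN opprK.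
  have := ler_wpM2l (ltW h0') (dirderN x (delta_mx 0 i)).
  by have := dirderZ x (- delta_mx 0 i) h0'; lra.
- by rewrite scale0r dirder0 mulr0.
Qed.

Lemma subgrad_le x h : F x + dot (subgrad x) h <= F (x + h).
Proof.
have := dirder_le_subgrad x (- h); have := dirder_ge x (- h).
rewrite dotNr opprK => h1 h2; lra.
Qed.

(** The second-difference bound combined with the lower bound [subgrad_le] at [- h]. *)
Lemma subgrad_ge r : exists C, forall x h, enorm x <= r -> enorm h <= 1 ->
  F (x + h) <= F x + dot (subgrad x) h + C * enorm h ^+ 2.
Proof.
have [C hC] := sF r; exists C => x h xr h1; have := hC x h xr h1.
have := subgrad_le x (- h); rewrite dotNr; lra.
Qed.

Lemma subgrad_grad x : differentiable F x /\ grad F x = subgrad x.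
Proof.
have [C hC] := subgrad_ge (enorm x); apply: (@grad_quadratic _ _ _ _ _ C) => h h1.
have := hC x h (lexx _) h1; have := subgrad_le x h.
by move=> lo up; rewrite ger0_norm; lra.
Qed.

Lemma convex_semiconcave_differentiable x : differentiable F x.
Proof. exact: (subgrad_grad x).1. Qed.

(* A convex function squeezed between its tangent plane at [x'] and its upper quadratic
   bound at [x] forces the gradients to differ by [O(|x - x'|)]. *)
Lemma convex_semiconcave_C11loc : C11loc F.
Proof.
split=> [x|p]; first exact: convex_semiconcave_differentiable.
have [C hC] := subgrad_ge (enorm p + 1).
exists (1 / 2), (2 * C); split; first by lra.
move=> x y; rewrite /cball /= => px py.
have [xp yp] : enorm x <= enorm p + 1 /\ enorm y <= enorm p + 1.
  split; rewrite -[X in enorm X <= _](subrK p); apply: le_trans (enorm_add _ _) _; lra.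
rewrite !(subgrad_grad _).2.
have xy1 : enorm (x - y) <= 1.
  by have := enorm_triangle p x y; rewrite (enormB p y); lra.
set d := enorm (x - y) in xy1 *; have d0 : 0 <= d by exact: enorm_ge0.
set g := subgrad x - subgrad y.
have key w : enorm w <= 1 -> dot g w <= C * d ^+ 2 + C * enorm w ^+ 2.
  move=> w1; have := hC y w yp w1.
  have := hC x (y - x) xp; rewrite -enormB -/d => /(_ xy1).
  have := subgrad_le x (y - x + w); rewrite [x + (y - x)]addrC addrA [x + _]addrC subrK.
  rewrite /g dotBl !dotDr; lra.
have [g0|g0] := eqVneq (enorm g) 0.
  have := key 0; rewrite enorm0 ler01 => /(_ isT).
  rewrite g0 dot0r expr0n /= mulr0 addr0.
  have [->|dn0] := eqVneq d 0; first by rewrite mulr0.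
  by rewrite expr2 mulrA pmulr_lge0 ?lt_neqAle ?d0 ?(eq_sym 0) ?dn0 //; lra.
have gp : 0 < enorm g by rewrite lt_neqAle eq_sym g0 enorm_ge0.
have [d00|dn0] := eqVneq d 0.
  have xy := enorm_eq0 d00; move/eqP : xy; rewrite subr_eq0 => /eqP xy.
  by move: gp; rewrite /g xy subrr enorm0 ltxx.
have dp : 0 < d by rewrite lt_neqAle eq_sym dn0 d0.
(* A test vector along [g] of length [d] makes the two quadratic errors equal. *)
have := key ((d / enorm g) *: g).
rewrite enormZ ger0_norm ?divr_ge0 ?enorm_ge0 // divfK // => /(_ xy1).
rewrite dotZr -sqr_enorm expr2 mulrA divfK //.
have -> : C * (d * d) + C * d ^+ 2 = d * (2 * C * d) by ring.
by rewrite ler_pM2l.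
Qed.

End ConvexSemiconcave.

(** * The extension as a hull of bumps *)

Section Extension.
Context {R : realType} {n : nat}.
Variables (E : set 'rV[R]_n) (f : 'rV[R]_n -> R) (G : 'rV[R]_n -> 'rV[R]_n).
Variable W : 'rV[R]_n -> 'rV[R]_n -> R.
Implicit Types (x y z h : 'rV[R]_n).

(** The penalty [W] stays abstract so that one argument serves both the paraboloids of the formula
    and the ramps used for unbounded [G]. *)
Definition upper_bump y x := f y + dot (G y) (x - y) + W y x.
Definition inf_bumps x := inf [set upper_bump y x | y in E].

Hypothesis E0 : E !=set0.
Hypothesis G_span : lin_span [set G x - G y | x in E & y in E] = setT.
Hypothesis W_diag : forall y, E y -> W y y <= 0.
Hypothesis W_ge : forall y z x, E y -> E z ->
  f z + dot (G z) (x - z) + 1 / 2 * enorm (x - y) ^+ 2 <= upper_bump y x.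
Hypothesis W_bounded : forall y, E y -> locally_bounded_above (W y).
Hypothesis W_semiconcave : forall r s, exists C, forall y x h,
  E y -> enorm y <= s -> enorm x <= r -> enorm h <= 2 ->
  W y (x + h) + W y (x - h) <= 2 * W y x + C * enorm h ^+ 2.

Lemma tangent_le_bump y z x : E y -> E z -> f z + dot (G z) (x - z) <= upper_bump y x.
Proof.
move=> Ey Ez; apply: le_trans (W_ge x Ey Ez).
by rewrite lerDl mulr_ge0 // sqr_ge0.
Qed.

Lemma bumps_has_inf x : has_inf [set upper_bump y x | y in E].
Proof.
have [z Ez] := E0; split; first by exists (upper_bump z x), z.
by exists (f z + dot (G z) (x - z)) => _ [y Ey <-]; exact: tangent_le_bump.
Qed.

Lemma inf_bumps_le y x : E y -> inf_bumps x <= upper_bump y x.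
Proof. by move=> Ey; apply: (ge_inf (bumps_has_inf x).2); exists y. Qed.

Lemma tangent_le_inf z x : E z -> f z + dot (G z) (x - z) <= inf_bumps x.
Proof.
move=> Ez; apply: lb_le_inf (bumps_has_inf x).1 _.
by move=> _ [y Ey <-]; exact: tangent_le_bump.
Qed.

Lemma tangent_affine z x : E z -> (f z - dot (G z) z) + dot (G z) x <= inf_bumps x.
Proof. by move=> /(tangent_le_inf x); rewrite dotBr; lra. Qed.

Lemma inf_bumps_bounded : locally_bounded_above inf_bumps.
Proof.
move=> r; have [z Ez] := E0; have [M hM] := W_bounded Ez r.
exists (f z + enorm (G z) * (r + enorm z) + M) => x xr.
apply: le_trans (inf_bumps_le x Ez) _; rewrite /upper_bump lerD ?hM // lerD2l.
apply: le_trans (dot_le _ _) _; rewrite ler_wpM2l ?enorm_ge0 //.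
by apply: le_trans (enorm_sub_le _ _) _; rewrite lerD2r.
Qed.

(* The quadratic gap in [W_ge] confines the near-minimizers of [inf_bumps x] to a
   bounded part of [E], on which the second differences of [W] are uniformly bounded. *)
Lemma inf_bumps_semiconcave : locally_semiconcave 2 inf_bumps.
Proof.
move=> r; have [z Ez] := E0; have [M hM] := inf_bumps_bounded r.
(* [m] bounds the tangent plane at [z] from below on the ball, so a bump within 1 of the infimum has
   |x - y|^2 <= D - 1, whence |x - y| <= D. *)
pose m := f z - dot (G z) z - enorm (G z) * r.
pose D := 2 * (M + 1 - m) + 1.
have [C hC] := W_semiconcave r (r + D).
exists C => x h xr h2; apply/ler_addgt0Pr => e e0.
have e2 : 0 < Num.min (e / 2) 1 by rewrite lt_min ltr01 andbT divr_gt0.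
have [_ [y Ey <-] /ltW] := inf_adherent e2 (bumps_has_inf x).
rewrite -/(inf_bumps x) => hy.
have m1 : Num.min (e / 2) 1 <= e / 2 by rewrite ge_min lexx.
have m2 : Num.min (e / 2) 1 <= 1 by rewrite ge_min lexx orbT.
have yD : enorm y <= r + D.
  have := W_ge x Ey Ez; have := hM x xr.
  have := norm_dot_le (G z) x; rewrite ler_norml => /andP[gx _].
  have := ler_wpM2l (enorm_ge0 (G z)) xr.
  rewrite dotBr => h3 h4 h5.
  have q : enorm (x - y) ^+ 2 <= D - 1 by rewrite /D /m; lra.
  have D1 : 1 <= D by have := sqr_ge0 (enorm (x - y)); lra.
  have xyD : enorm (x - y) <= D.
    have := enorm_ge0 (x - y); move: q D1; set a := enorm _ => q D1 a0; nra.
  have -> : y = x - (x - y) by rewrite opprB addrC subrK.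
  by apply: le_trans (enorm_sub_le _ _) _; rewrite lerD.
have := hC y x h Ey yD xr h2.
have := inf_bumps_le (x + h) Ey; have := inf_bumps_le (x - h) Ey.
move: hy; rewrite /upper_bump !(dotBr, dotDr); lra.
Qed.

(** The tangent planes at points of [E] are affine minorants, so every [G x - G y] is a controlled
    direction, and these span the space. *)
Lemma inf_bumps_controlled w : controlled inf_bumps w.
Proof.
have sub : lin_span [set G x - G y | x in E & y in E] `<=` controlled inf_bumps.
  apply: controlled_span => _ [x Ex [y Ey <-]].
  by apply: controlled_slopes => u; exact: tangent_affine.
by apply: sub; rewrite G_span.
Qed.

Lemma hull_bumps_extension : convex_C11loc_extension E f G (hull inf_bumps).
Proof.
have [z Ez] := E0; have aff := fun x => tangent_affine x Ez.
have cF := hull_convex aff.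
have sF := hull_semiconcave aff inf_bumps_controlled inf_bumps_bounded inf_bumps_semiconcave.
have ge y x : E y -> f y + dot (G y) (x - y) <= hull inf_bumps x.
  move=> Ey; have := @le_hull _ _ _ _ _ aff _ (convex_affine (f y - dot (G y) y) (G y)).
  by move=> /(_ (fun u => tangent_affine u Ey) x); rewrite dotBr; lra.
have eq y : E y -> hull inf_bumps y = f y.
  move=> Ey; apply/eqP; rewrite eq_le; apply/andP; split; last first.
    by have := ge y y Ey; rewrite subrr dot0r addr0.
  apply: le_trans (hull_le aff y) _; apply: le_trans (inf_bumps_le y Ey) _.
  by rewrite /upper_bump subrr dot0r addr0 gerDl W_diag.
split => //; first exact: convex_semiconcave_C11loc.
move=> y Ey; rewrite (subgrad_grad cF sF y).2.
have [C hC] := subgrad_ge cF sF (enorm y).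
(* At [y - h] the envelope is above the plane of slope [G y] and below the quadratic bound of slope
   [subgrad y], so the slopes differ by a form of quadratic size. *)
apply/eqP; rewrite -subr_eq0; apply/eqP/(@dot_quadratic_eq0 _ _ _ C) => h h1.
have := hC y (- h) (lexx _); rewrite enormN => /(_ h1).
have := ge y (y - h) Ey; rewrite [y - h]addrC addrK (eq y Ey) !dotNr dotBl; lra.
Qed.

Lemma hull_bumps_conv_env x : (hull inf_bumps x)%:E =
  conv_env (fun x => ereal_inf [set (upper_bump y x)%:E | y in E]) x.
Proof.
have [z Ez] := E0; have aff := fun x => tangent_affine x Ez.
rewrite (hull_conv_env aff); congr conv_env; apply/funext => u.
rewrite /inf_bumps -ereal_inf_EFin ?image_comp //.
  exact: (bumps_has_inf u).2.
exact: (bumps_has_inf u).1.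
Qed.

End Extension.

(** * Paraboloids and ramps *)

Section Penalties.
Context {R : realType} {n : nat}.
Implicit Types (x y z h : 'rV[R]_n).

Lemma first_radius_gt0 y : (0 < first_radius y)%N.
Proof. by rewrite /first_radius; case: ex_minnP => k /andP[]. Qed.

Lemma enorm_le_first_radius y : enorm y <= (first_radius y)%:R.
Proof.
rewrite /first_radius; case: ex_minnP => k /andP[_ /set_mem h] _.
by move: h; rewrite /cball /= subr0.
Qed.

Lemma first_radius_le y k : (0 < k)%N -> enorm y <= k%:R -> (first_radius y <= k)%N.
Proof.
move=> k0 yk; rewrite /first_radius; case: ex_minnP => j _; apply.
by rewrite k0; apply/mem_set; rewrite /cball /= subr0.
Qed.

Lemma le_pos_nat (s : R) : exists2 N, (0 < N)%N & s <= N%:R.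
Proof.
exists (Num.bound `|s|).+1 => //; apply: le_trans (ler_norm _) _; apply/ltW.
by apply: lt_le_trans (archi_boundP (normr_ge0 _)) _; rewrite ler_nat.
Qed.

Lemma first_radius_bounded (s : R) :
  exists N, forall y, enorm y <= s -> (first_radius y <= N)%N.
Proof.
have [N N0 sN] := le_pos_nat s; exists N => y ys.
by apply: first_radius_le => //; exact: le_trans sN.
Qed.

Lemma seq_bounded (A : nat -> R) N : exists B, forall k, (k <= N)%N -> A k <= B.
Proof.
exists (\sum_(j < N.+1) `|A j|) => k kN.
rewrite (bigD1 (Ordinal (kN : (k < N.+1)%N))) //=.
by apply: le_trans (ler_norm _) _; rewrite lerDl sumr_ge0.
Qed.

Lemma enorm_parallelogram x h :
  enorm (x + h) ^+ 2 + enorm (x - h) ^+ 2 = 2 * enorm x ^+ 2 + 2 * enorm h ^+ 2.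
Proof. by rewrite !sqr_enorm !(dotDl, dotDr, dotNl, dotNr); ring. Qed.

Lemma paraboloid_bounded (a : R) y :
  locally_bounded_above (fun x => a * enorm (x - y) ^+ 2).
Proof.
move=> r; exists (`|a| * (r + enorm y) ^+ 2) => x xr.
apply: le_trans (ler_wpM2r (sqr_ge0 _) (ler_norm a)) _.
have xy : enorm (x - y) <= r + enorm y.
  by apply: le_trans (enorm_sub_le _ _) _; rewrite lerD2r.
by rewrite ler_wpM2l // ler_pXn2r // nnegrE ?enorm_ge0 // (le_trans _ xy) ?enorm_ge0.
Qed.

Lemma paraboloid_semiconcave (a : R) y x h :
  a * enorm (x + h - y) ^+ 2 + a * enorm (x - h - y) ^+ 2 =
  2 * (a * enorm (x - y) ^+ 2) + 2 * a * enorm h ^+ 2.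
Proof.
rewrite [x + h - y]addrAC [x - h - y]addrAC -mulrDr enorm_parallelogram; ring.
Qed.

(** Vanishes on the ball of radius [j]; squaring the positive part removes its kink, so second
    differences are bounded on balls. *)
Definition ramp (j : nat) x := Num.max 0 (enorm x ^+ 2 - j%:R ^+ 2) ^+ 2.

Lemma ramp_ge0 j x : 0 <= ramp j x.
Proof. exact: sqr_ge0. Qed.

Lemma ramp_eq0 (j : nat) x : enorm x <= j%:R -> ramp j x = 0.
Proof.
move=> xj; rewrite /ramp max_l ?expr0n // subr_le0.
by rewrite ler_pXn2r // nnegrE ?enorm_ge0.
Qed.

Lemma ramp_le (j : nat) x (M : R) : enorm x <= M -> ramp j x <= (M ^+ 2) ^+ 2.
Proof.
move=> xM; have M0 := le_trans (enorm_ge0 x) xM.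
have : enorm x ^+ 2 <= M ^+ 2 by rewrite ler_pXn2r // nnegrE // enorm_ge0.
have := sqr_ge0 (j%:R : R); have := sqr_ge0 M => a b c.
by rewrite /ramp ler_pXn2r ?nnegrE ?le_max ?lexx // ge_max a; lra.
Qed.

(** Taylor's bound for the squared positive part, whose derivative 2 max(0, s) is 2-Lipschitz. *)
Lemma sqr_pos_part_le (s d : R) :
  Num.max 0 (s + d) ^+ 2 <= Num.max 0 s ^+ 2 + 2 * Num.max 0 s * d + d ^+ 2.
Proof.
case: (lerP 0 s) => s0; case: (lerP 0 (s + d)) => sd.
- by rewrite le_eqVlt; apply/orP; left; apply/eqP; ring.
- by rewrite expr0n /=; have := sqr_ge0 (s + d); lra.
- rewrite expr0n /= mulr0 mul0r !add0r ler_pXn2r ?nnegrE //; lra.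
- by rewrite expr0n /= mulr0 mul0r !add0r sqr_ge0.
Qed.

(** [sqr_pos_part_le] is applied to the increments |x +- h|^2 - |x|^2, which are at most (2 M + 2)
    |h| in size; their terms linear in [h] cancel in the sum. *)
Lemma ramp_semiconcave (j : nat) x h (M : R) : enorm x <= M -> enorm h <= 2 ->
  ramp j (x + h) + ramp j (x - h) <=
  2 * ramp j x + (4 * M ^+ 2 + 2 * (2 * M + 2) ^+ 2) * enorm h ^+ 2.
Proof.
move=> xM h2; have x0 := enorm_ge0 x; have h0 := enorm_ge0 h.
have M0 := le_trans x0 xM.
have step (e : R) : `|e| = 1 -> ramp j (x + e *: h) <=
    ramp j x + 2 * Num.max 0 (enorm x ^+ 2 - j%:R ^+ 2) * (2 * e * dot x h + enorm h ^+ 2)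
    + (2 * M + 2) ^+ 2 * enorm h ^+ 2.
  move=> e1; set d := 2 * e * dot x h + enorm h ^+ 2.
  have e2 : e ^+ 2 = 1 by rewrite -real_normK ?num_real // e1 expr1n.
  have -> : ramp j (x + e *: h) = Num.max 0 (enorm x ^+ 2 - j%:R ^+ 2 + d) ^+ 2.
    rewrite /ramp /d; congr (Num.max _ _ ^+ 2).
    rewrite !sqr_enorm !(dotDl, dotDr, dotZl, dotZr) (dotC h x).
    have -> : e * (e * dot h h) = e ^+ 2 * dot h h by ring.
    by rewrite e2; ring.
  apply: le_trans (sqr_pos_part_le _ _) _; rewrite lerD2l -exprMn.
  have dle : `|d| <= (2 * M + 2) * enorm h.
    apply: le_trans (ler_normD _ _) _; rewrite !normrM e1 mulr1 (ger0_norm h0) normr_nat.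
    have := norm_dot_le x h; have := ler_wpM2r h0 xM; have := ler_wpM2r h0 h2; lra.
  rewrite -(real_normK (num_real d)) ler_pXn2r // nnegrE //.
  exact: le_trans dle.
have := step 1; have := step (-1); rewrite normrN normr1 => /(_ erefl) hm /(_ erefl) hp.
move: hm hp; rewrite scaleN1r scale1r => hm hp.
have mx : Num.max 0 (enorm x ^+ 2 - j%:R ^+ 2) <= M ^+ 2.
  have : enorm x ^+ 2 <= M ^+ 2 by rewrite ler_pXn2r // nnegrE.
  have := sqr_ge0 (j%:R : R); have := sqr_ge0 M => a b c.
  by rewrite ge_max a; lra.
have := ler_wpM2r (sqr_ge0 (enorm h)) mx; lra.
Qed.

(** The locally finite series of the [c j * ramp j] over j >= k, cut at [first_radius x], beyond
    which all ramps vanish at [x]. *)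
Definition tower (c : nat -> R) (k : nat) x :=
  \sum_(0 <= j < first_radius x | (k <= j)%N) c j * ramp j x.

(** A common cutoff allows values of the tower at different points to be compared term by term. *)
Lemma towerE c k x (M : nat) : (0 < M)%N -> enorm x <= M%:R ->
  tower c k x = \sum_(0 <= j < M | (k <= j)%N) c j * ramp j x.
Proof.
move=> M0 xM; rewrite /tower [RHS](big_cat_nat (leq0n _) (first_radius_le M0 xM)) /=.
rewrite [X in _ = _ + X]big_nat_cond [X in _ = _ + X]big1 ?addr0 // => j /andP[/andP[jx _] _].
rewrite ramp_eq0 ?mulr0 //; apply: le_trans (enorm_le_first_radius x) _.
by rewrite ler_nat.
Qed.

Section Tower.
Variable c : nat -> R.
Hypothesis c0 : forall j, 0 <= c j.

Lemma tower_ge0 k x : 0 <= tower c k x.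
Proof. by apply: sumr_ge0 => j _; rewrite mulr_ge0 ?ramp_ge0. Qed.

Lemma tower_ge k j x : (k <= j < first_radius x)%N -> c j * ramp j x <= tower c k x.
Proof.
move=> /andP[kj jx]; rewrite /tower big_mkord (bigD1 (Ordinal jx)) //=.
by rewrite lerDl sumr_ge0 // => i _; rewrite mulr_ge0 ?ramp_ge0.
Qed.

Lemma tower_eq0 (k : nat) x : (0 < k)%N -> enorm x <= k%:R -> tower c k x = 0.
Proof.
move=> k0 xk; rewrite (towerE c k k0 xk) big_nat_cond big1 // => j /andP[/andP[_ jk]].
by rewrite leqNgt jk.
Qed.

Lemma tower_bounded k : locally_bounded_above (tower c k).
Proof.
move=> r; have [M M0 rM] := le_pos_nat r.
exists (\sum_(0 <= j < M | (k <= j)%N) c j * (M%:R ^+ 2) ^+ 2) => x xr.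
have xM : enorm x <= M%:R by exact: le_trans rM.
rewrite (@towerE c k x M) //; apply: ler_sum => j _.
by rewrite ler_wpM2l // ramp_le.
Qed.

Lemma tower_semiconcave r : exists C, forall k x h, enorm x <= r -> enorm h <= 2 ->
  tower c k (x + h) + tower c k (x - h) <= 2 * tower c k x + C * enorm h ^+ 2.
Proof.
(* The margin 2 keeps [x], [x + h] and [x - h] under one cutoff. The constant below sums over all j
   < M, hence does not depend on [k]. *)
have [M M0 rM] := le_pos_nat (r + 2).
pose K : R := 4 * M%:R ^+ 2 + 2 * (2 * M%:R + 2) ^+ 2.
have K0 : 0 <= K by rewrite addr_ge0 // mulr_ge0 // sqr_ge0.
exists (\sum_(0 <= j < M) c j * K) => k x h xr h2.
have := enorm_ge0 x; have := enorm_ge0 h => h0 x0.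
have xM : enorm x <= M%:R by lra.
have xp : enorm (x + h) <= M%:R by apply: le_trans (enorm_add _ _) _; lra.
have xm : enorm (x - h) <= M%:R by apply: le_trans (enorm_sub_le _ _) _; lra.
rewrite (towerE c k M0 xM) (towerE c k M0 xp) (towerE c k M0 xm).
apply: (@le_trans _ _ (\sum_(0 <= j < M | (k <= j)%N)
    (2 * (c j * ramp j x) + c j * K * enorm h ^+ 2))).
  rewrite -big_split; apply: ler_sum => j _ /=.
  by have := ler_wpM2l (c0 j) (ramp_semiconcave j xM h2); rewrite -/K; lra.
rewrite big_split mulr_sumr lerD2l -[leLHS]mulr_suml ler_wpM2r ?sqr_ge0 //.
rewrite big_mkcond; apply: ler_sum => j _; case: ifP => // _.
by rewrite mulr_ge0.
Qed.

End Tower.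

(** * Sufficiency: bumps for general and for bounded [G] *)

Section Sufficiency.
Variables (E : set 'rV[R]_n) (f : 'rV[R]_n -> R) (G : 'rV[R]_n -> 'rV[R]_n).
Variable A : nat -> R.
Hypothesis E0 : E !=set0.
Hypothesis G_span : lin_span [set G x - G y | x in E & y in E] = setT.
Hypothesis A_jet : forall k, (0 < k)%N -> 2 <= A k /\ jet_condition E f G k (A k).

Lemma jet_conditionW (k : nat) y z x : (0 < k)%N -> E y -> E z ->
  enorm y <= k%:R -> enorm x <= 4 * k%:R ->
  f z + dot (G z) (x - z) <= f y + dot (G y) (x - y) + A k / 2 * enorm (x - y) ^+ 2.
Proof.
by move=> k0 Ey Ez yk xk; apply: (A_jet k0).2; rewrite /cball /= ?subr0.
Qed.

(* If [N = first_radius x] exceeds [4 * first_radius y], then [ramp (N - 2) x >= 1] and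
   [|x - y| <= 2 N], so the ramp of index [N - 2] alone dominates [A N / 2 * |x - y| ^ 2]. *)
Definition tower_bump y x :=
  2^-1 * (A (first_radius y) + 1) * enorm (x - y) ^+ 2 +
  tower (fun j => 2 * `|A j.+2| * j.+2%:R ^+ 2) (first_radius y) x.

Let c0 j : 0 <= 2 * `|A j.+2| * j.+2%:R ^+ 2 :> R.
Proof. by rewrite !mulr_ge0 // sqr_ge0. Qed.

Lemma tower_bump_extension : exists F, convex_C11loc_extension E f G F.
Proof.
exists (hull (inf_bumps E f G tower_bump)); apply: hull_bumps_extension => //.
- move=> y Ey; rewrite /tower_bump subrr enorm0 expr0n mulr0 add0r.
  by rewrite tower_eq0 ?first_radius_gt0 ?enorm_le_first_radius.
- move=> y z x Ey Ez; rewrite /upper_bump /tower_bump.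
  have k0 := first_radius_gt0 y; have yk := enorm_le_first_radius y.
  have T0 := tower_ge0 c0 (first_radius y) x.
  set k := first_radius y in k0 yk T0 *.
  (* Within 4 k the jet condition at level [k] applies, and the [+ 1] in the coefficient supplies
     the margin |x - y|^2 / 2. *)
  case: (lerP (enorm x) (4 * k%:R)) => xk.
    by have := jet_conditionW k0 Ey Ez yk xk; lra.
  have N0 := first_radius_gt0 x; have xN := enorm_le_first_radius x.
  have kN : (4 * k < first_radius x)%N.
    by rewrite -(ltr_nat R) natrM; exact: lt_le_trans xk xN.
  have xN1 : (first_radius x).-1%:R < enorm x.
    rewrite ltNge; apply/negP => xle.
    have := @first_radius_le x (first_radius x).-1; move: kN k0 => + + /(_ _ xle).
    by set N := first_radius x; move=> a b d; suff : (N <= N.-1)%N; [|apply: d]; lia.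
  have := @tower_ge _ c0 k (first_radius x).-2 x.
  case: (first_radius x) N0 xN kN xN1 => [|[|N]] // _ xN kN xN1 /=.
    by move: kN k0; lia.
  have kN2 : (k <= N < N.+2)%N by apply/andP; split; lia.
  move=> /(_ kN2) tN.
  (* Minimality of [first_radius x], now N + 2, gives |x| > N + 1, so |x|^2 - N^2 >= 2 N + 1. The
     ramp of index N + 1 could be arbitrarily small here. *)
  have ramp1 : 1 <= ramp N x.
    have N0 : (0 : R) <= N%:R by [].
    have a : 1 <= enorm x ^+ 2 - N%:R ^+ 2.
      have : N.+1%:R ^+ 2 <= enorm x ^+ 2.
        by rewrite ler_pXn2r ?nnegrE ?enorm_ge0 // ltW.
      by rewrite -natr1; nra.
    have a0 := le_trans ler01 a.
    by rewrite /ramp max_r // -[leLHS](expr1n _ 2) ler_pXn2r // nnegrE.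
  have yN : enorm y <= N.+2%:R by apply: le_trans yk _; rewrite ler_nat; lia.
  have x4 : enorm x <= 4 * N.+2%:R.
    by apply: le_trans xN _; rewrite ler_peMl // ler1n.
  have := jet_conditionW (isT : (0 < N.+2)%N) Ey Ez yN x4.
  have xy : enorm (x - y) ^+ 2 <= 4 * N.+2%:R ^+ 2.
    have -> : 4 * N.+2%:R ^+ 2 = (2 * N.+2%:R) ^+ 2 :> R by ring.
    rewrite ler_pXn2r ?nnegrE ?enorm_ge0 ?mulr_ge0 //.
    by apply: le_trans (enorm_sub_le _ _) _; lra.
  have := (A_jet k0).1; have := (A_jet (isT : (0 < N.+2)%N)).1.
  move=> AN Ak.
  have AN0 : `|A N.+2| = A N.+2 by rewrite ger0_norm; lra.
  have := ler_wpM2l (c0 N) ramp1; rewrite mulr1 AN0 => h1.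
  have h2 : A N.+2 / 2 * enorm (x - y) ^+ 2 <= 2 * A N.+2 * N.+2%:R ^+ 2.
    have A2 : 0 <= A N.+2 / 2 by lra.
    by have := ler_wpM2l A2 xy; lra.
  have h3 : 0 <= A k * enorm (x - y) ^+ 2 by rewrite mulr_ge0 ?sqr_ge0 //; lra.
  move: tN; rewrite AN0; lra.
- move=> y Ey r; have [M1 h1] := @paraboloid_bounded (2^-1 * (A (first_radius y) + 1)) y r.
  have [M2 h2] := tower_bounded c0 (first_radius y) r.
  by exists (M1 + M2) => x xr; rewrite lerD ?h1 ?h2.
- move=> r s; have [C hC] := tower_semiconcave c0 r.
  have [N hN] := first_radius_bounded s; have [B hB] := seq_bounded A N.
  exists (B + 1 + C) => y x h Ey ys xr h2; rewrite /tower_bump.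
  have := paraboloid_semiconcave (2^-1 * (A (first_radius y) + 1)) y x h.
  have := hC (first_radius y) x h xr h2.
  have := ler_wpM2r (sqr_ge0 (enorm h)) (hB _ (hN y ys)); lra.
Qed.

Definition paraboloid y x :=
  2^-1 * (A (first_radius y) + 4 * sup_norm_on E G + 1) * enorm (x - y) ^+ 2.

(** Beyond 4 k, |x - y| >= 1, so the slope difference costs at most 2 |G| |x - y| <= 2 |G| |x -
    y|^2, with |G| the sup norm; this is the term 4 |G| / 2 of the coefficient. *)
Lemma paraboloid_extension : has_ubound [set enorm (G x) | x in E] ->
  let F := hull (inf_bumps E f G paraboloid) in
  convex_C11loc_extension E f G F /\
  forall x, (F x)%:E = conv_env (inf_paraboloids E f G A) x.
Proof.
move=> Gb F.
have Gle y : E y -> enorm (G y) <= sup_norm_on E G.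
  by move=> Ey; apply: ub_le_sup => //; exists y.
have g0 : 0 <= sup_norm_on E G.
  by have [z Ez] := E0; exact: le_trans (enorm_ge0 _) (Gle z Ez).
have W_ge y z x : E y -> E z -> f z + dot (G z) (x - z) + 1 / 2 * enorm (x - y) ^+ 2
    <= upper_bump f G paraboloid y x.
  move=> Ey Ez; rewrite /upper_bump /paraboloid; set g := sup_norm_on E G.
  have k0 := first_radius_gt0 y; have yk := enorm_le_first_radius y.
  set k := first_radius y in k0 yk *.
  have q0 := sqr_ge0 (enorm (x - y)).
  case: (lerP (enorm x) (4 * k%:R)) => xk.
    have := jet_conditionW k0 Ey Ez yk xk.
    have := mulr_ge0 g0 q0; rewrite -/g; lra.
  have k1 : (1 : R) <= k%:R by rewrite ler1n.
  have y4 : enorm y <= 4 * k%:R by lra.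
  (* The jet condition at the point [y] itself: the tangent plane at [z] is at most [f y] there. *)
  have := jet_conditionW k0 Ey Ez yk y4.
  rewrite subrr dot0r enorm0 expr0n /= mulr0 !addr0 => fzy.
  have xy1 : 1 <= enorm (x - y).
    by have := enorm_add (x - y) y; rewrite subrK; lra.
  have := dot_le (G z - G y) (x - y).
  have Gzy : enorm (G z - G y) <= 2 * g.
    apply: le_trans (enorm_sub_le _ _) _.
    by have := Gle z Ez; have := Gle y Ey; rewrite -/g; lra.
  have := ler_wpM2r (enorm_ge0 (x - y)) Gzy.
  have e1 : enorm (x - y) <= enorm (x - y) ^+ 2 by rewrite expr2 ler_peMl // enorm_ge0.
  have g20 : 0 <= 2 * g by rewrite mulr_ge0.
  have := ler_wpM2l g20 e1.
  have Ak0 : 0 <= A k by have := (A_jet k0).1; lra.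
  have := mulr_ge0 Ak0 q0.
  move: fzy; rewrite !(dotBl, dotBr); lra.
split; last by move=> x; exact: (hull_bumps_conv_env E0 W_ge).
apply: hull_bumps_extension => //.
- by move=> y _; rewrite /paraboloid subrr enorm0 expr0n mulr0.
- by move=> y _; exact: paraboloid_bounded.
- move=> r s; have [N hN] := first_radius_bounded s; have [B hB] := seq_bounded A N.
  exists (B + 4 * sup_norm_on E G + 1) => y x h Ey ys xr h2; rewrite /paraboloid.
  rewrite paraboloid_semiconcave.
  have := ler_wpM2r (sqr_ge0 (enorm h)) (hB _ (hN y ys)); lra.
Qed.

End Sufficiency.
End Penalties.

(** * Necessity *)

Section Necessity.
Context {R : realType} {n : nat}.
Implicit Types (x y z h : 'rV[R]_n) (H : 'rV[R]_n -> 'rV[R]_n).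

(** Boxes replace Euclidean balls because, as products of segments, they are directly compact, and
    they are convex. *)
Definition box (M : R) : set 'rV[R]_n := [set v | forall i, v 0 i \in `[- M, M]].

Lemma box_compact M : compact (box M).
Proof.
apply: (@rV_compact _ _ (fun=> `[- M, M]%classic)) => _; exact: segment_compact.
Qed.

Lemma box_conv M (t : R) x y : 0 <= t <= 1 -> box M x -> box M y ->
  box M (t *: x + (1 - t) *: y).
Proof.
move=> /andP[t0 t1] bx by_ i; move: (bx i) (by_ i); rewrite !in_itv /= !mxE.
by move=> /andP[a b] /andP[c d]; apply/andP; split; nra.
Qed.

Lemma enorm_le_box M x : enorm x <= M -> box M x.
Proof.
by move=> xM i; rewrite in_itv /= -ler_norml; exact: le_trans (norm_coord_le x i) xM.
Qed.

Lemma near_enormB x (e : R) : 0 < e -> \forall y \near x, enorm (y - x) <= e.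
Proof.
move=> /(@near_enorm R n); rewrite (near_shift x 0); apply: filterS => y.
by rewrite /= sub0r.
Qed.

(** Compactness gives one scale and one constant for all points of the box; repeated bisection,
    within the convex box, extends the estimate to all distances. *)
Lemma locally_lipschitz_box H M : locally_lipschitz H ->
  exists L : R, 0 <= L /\ forall x y, box M x -> box M y ->
    enorm (H x - H y) <= L * enorm (x - y).
Proof.
move=> lipH.
(* [N] encodes both the radius 1/(N+1) and the constant N, so the local estimate holds for all large
   [N]. *)
pose P (N : nat) p := forall x y, cball p N.+1%:R^-1 x -> cball p N.+1%:R^-1 y ->
  enorm (H x - H y) <= N%:R * enorm (x - y).
have : \forall N \near \oo, box M `<=` P N.
  apply: ((compact_near_coveringP _).1 (@box_compact M)) => p _.
  have [r [L [r0 HL]]] := lipH p.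
  have r20 : 0 < r / 2 by rewrite divr_gt0.
  near=> q N => x y.
  have qp : enorm (q - p) <= r / 2.
    by near: q; exact: near_enormB.
  have Nr : N.+1%:R^-1 <= r / 2.
    by near: N; apply: filterS (near_infty_natSinv_lt (PosNum r20)) => k /ltW.
  have NL : L <= N%:R by near: N; exact: nbhs_infty_ger.
  rewrite /cball /= => qx qy; apply: le_trans (HL x y _ _) _.
  - rewrite /cball /=; have := enorm_triangle q x p; have := le_trans qx Nr; lra.
  - rewrite /cball /=; have := enorm_triangle q y p; have := le_trans qy Nr; lra.
  - by rewrite ler_wpM2r // enorm_ge0.
move=> [N _ /(_ N (leqnn N))] /= HN; exists N%:R; split => // x y bx by_.
have main j : forall x y, box M x -> box M y -> enorm (x - y) <= 2 ^+ j * N.+1%:R^-1 ->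
    enorm (H x - H y) <= N%:R * enorm (x - y).
  elim: j {x y bx by_} => [|j IH] x y bx by_ xy.
    apply: (HN y by_); rewrite /cball /= ?subrr ?enorm0 ?invr_ge0 //.
    by move: xy; rewrite expr0 mul1r.
  pose m := (1 / 2) *: x + (1 - 1 / 2) *: y.
  have bm : box M m by apply: box_conv => //; apply/andP; split; lra.
  have xm : enorm (x - m) = 1 / 2 * enorm (x - y).
    have -> : x - m = (1 / 2) *: (x - y) by apply/rowP => i; rewrite !mxE; field.
    by rewrite enormZ ger0_norm.
  have my : enorm (m - y) = 1 / 2 * enorm (x - y).
    have -> : m - y = (1 / 2) *: (x - y) by apply/rowP => i; rewrite !mxE; field.
    by rewrite enormZ ger0_norm.
  have {}xy : 1 / 2 * enorm (x - y) <= 2 ^+ j * N.+1%:R^-1.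
    by move: xy; rewrite exprS -mulrA; set d := _ * N.+1%:R^-1; lra.
  have := IH x m bx bm; rewrite xm => /(_ xy) h1.
  have := IH m y bm by_; rewrite my => /(_ xy) h2.
  apply: le_trans (enorm_triangle (H m) _ _) _; lra.
have [j j0 hj] := le_pos_nat (enorm (x - y) * N.+1%:R).
apply: (main j) => //; rewrite ler_pdivlMr //; apply: le_trans hj _.
by rewrite -natrX ler_nat ltnW // ltn_expl.
Unshelve. all: by end_near. Qed.

Lemma mvt_grad (F : 'rV[R]_n -> R) x y : (forall z, differentiable F z) ->
  exists2 t, 0 <= t <= 1 &
    F x - F y = dot (grad F (t *: x + (1 - t) *: y)) (x - y).
Proof.
move=> dF; set h := x - y; pose phi (t : R) := F (y + t *: h).
(* The difference quotients of [phi] at [t] are those of [F] at [y + t *: h] in direction [h]. *)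
have E (t : R) : (fun s : R => s^-1 *: ((phi \o shift t) (s *: 1) - phi t)) =
    (fun s : R => s^-1 *: ((F \o shift (y + t *: h)) (s *: h) - F (y + t *: h))).
  apply/funext => s; rewrite /phi /= [s *: 1]mulr1 scalerDl.
  by rewrite addrCA.
have D t : is_derive t (1 : R) phi (dot (grad F (y + t *: h)) h).
  have dh : derivable F (y + t *: h) h by exact: diff_derivable.
  split; first by rewrite /derivable E.
  by rewrite /derive E -differentiable_grad.
have cphi : {within `[0, 1], continuous phi}.
  by apply: derivable_within_continuous => t _; have [] := D t.
have [t t01] := MVT_segment ler01 (fun t _ => D t) cphi.
rewrite subr0 mulr1 /phi scale1r scale0r addr0 [y + h]addrC subrK => ->.
exists t; first by move: t01; rewrite in_itv.
congr (dot (grad F _) _); rewrite /h scalerBr scalerBl scale1r.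
by rewrite addrCA.
Qed.

Lemma quadratic_error (F : 'rV[R]_n -> R) (M : R) : C11loc F ->
  exists L, 0 <= L /\ forall x y, box M x -> box M y ->
    `|F x - F y - dot (grad F y) (x - y)| <= L * enorm (x - y) ^+ 2.
Proof.
move=> [dF lF]; have [L [L0 HL]] := locally_lipschitz_box M lF.
exists L; split => // x y bx by_; have [t t01 ->] := mvt_grad x y dF.
rewrite -dotBl; apply: le_trans (norm_dot_le _ _) _.
rewrite expr2 mulrA ler_wpM2r ?enorm_ge0 //.
apply: le_trans (HL _ _ (box_conv t01 bx by_) by_) _.
rewrite ler_wpM2l //.
have -> : t *: x + (1 - t) *: y - y = t *: (x - y).
  by apply/rowP => i; rewrite !mxE; ring.
move/andP: t01 => [t0 t1].
by rewrite enormZ ger0_norm // ler_piMl // enorm_ge0.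
Qed.

(** Convexity on the segment and the quadratic error at y + t (x - y) give the inequality up to L t
    |x - y|^2, with t small. *)
Lemma convex_C11loc_tangent_le (F : 'rV[R]_n -> R) : convex_function setT F -> C11loc F ->
  forall x y, F y + dot (grad F y) (x - y) <= F x.
Proof.
move=> /convex_functionTP cF CF x y.
have [L [L0 HL]] := quadratic_error (enorm x + enorm y) CF.
have bx : box (enorm x + enorm y) x by apply: enorm_le_box; rewrite lerDl enorm_ge0.
have by_ : box (enorm x + enorm y) y by apply: enorm_le_box; rewrite lerDr enorm_ge0.
apply/ler_addgt0Pr => e e0.
pose K := L * enorm (x - y) ^+ 2 + 1.
have K0 : 0 < K by rewrite ltr_pwDr // mulr_ge0 // sqr_ge0.
pose t := Num.min (e / K) 1.
have t0 : 0 < t by rewrite lt_min divr_gt0 //=.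
have tK : t * K <= e by rewrite -ler_pdivlMr // ge_min lexx.
have t1 : t <= 1 by rewrite ge_min lexx orbT.
have t01 : 0 <= t <= 1 by rewrite ltW.
have := HL _ _ (box_conv t01 bx by_) by_; have := cF t x y t01.
have -> : t *: x + (1 - t) *: y - y = t *: (x - y).
  by apply/rowP => i; rewrite !mxE; ring.
rewrite dotZr enormZ (ger0_norm (ltW t0)) ler_norml => h1 /andP[h2 _].
rewrite -(ler_pM2l t0).
have := ler_wpM2l (ltW t0) tK; have := sqr_ge0 t; rewrite /K; lra.
Qed.

Lemma extension_jet_condition (E : set 'rV[R]_n) f G F (k : nat) :
  convex_C11loc_extension E f G F -> (0 < k)%N ->
  exists2 a : R, 2 <= a & jet_condition E f G k a.
Proof.
move=> [cF CF Ff FG] k0.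
have [L [L0 HL]] := quadratic_error (4 * k%:R) CF.
(* Half of this constant exceeds [L], and the summand 2 ensures the lower bound 2. *)
exists (2 * L + 2); first by lra.
move=> z y x Ez [Ey]; rewrite /cball /= !subr0 => yk xk.
rewrite -!Ff // -!FG //; apply: le_trans (convex_C11loc_tangent_le cF CF x z) _.
have k1 : (0 : R) <= k%:R by [].
have y4 : enorm y <= 4 * k%:R by lra.
have := HL x y (enorm_le_box xk) (enorm_le_box y4); rewrite ler_norml => /andP[_].
have := sqr_ge0 (enorm (x - y)); lra.
Qed.

End Necessity.

Theorem theorem1p3 (R : realType) (n : nat) (E : set 'rV[R]_n)
    (f : 'rV[R]_n -> R) (G : 'rV[R]_n -> 'rV[R]_n) :
  E !=set0 ->
  lin_span [set G x - G y | x in E & y in E] = setT ->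
  ((exists F : 'rV[R]_n -> R, convex_C11loc_extension E f G F) <->
   (forall k : nat, (0 < k)%N ->
      exists2 a : R, 2 <= a & jet_condition E f G k a)) /\
  (forall A : nat -> R,
     (forall k : nat, (0 < k)%N -> 2 <= A k /\ jet_condition E f G k (A k)) ->
     has_ubound [set enorm (G x) | x in E] ->
     exists F : 'rV[R]_n -> R,
       convex_C11loc_extension E f G F /\
       forall x, (F x)%:E = conv_env (inf_paraboloids E f G A) x).
Proof.
move=> E0 G_span; split; first split.
- by move=> [F ext] k; exact: extension_jet_condition ext.
- move=> jet.
  (* Nothing is required at k = 0, where the value 0 is taken. *)
  have /choice[A A_jet] k : exists a, (0 < k)%N -> 2 <= a /\ jet_condition E f G k a.
    by case: (ltnP 0 k) => [/jet[a a2 ja]|_]; [exists a | exists 0].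
  exact: tower_bump_extension A_jet.
- move=> A A_jet Gb; eexists; exact: paraboloid_extension E0 G_span A_jet Gb.
Qed.
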